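(* Let $k,r,t$ be integers with $5\leq k\leq t-1$, $1\leq r\leq k-2$ and $t\geq 2r+2$. Write $t-2=p(k-2)+q$ with $p$ an integer and $q\in\{0,1,\ldots,k-3\}$. Then $$\operatorname{gr}_k(P_5:S_t^r)=\max\{t+p-1,\;t+1\}.$$
   Context: All graphs are finite, simple and undirected. $K_n$ is the complete graph on $n$ vertices and $P_5$ is the path with $5$ vertices and $4$ edges. $S_t^r$ is the graph of order $t$ obtained from the star $K_{1,t-1}$ by adding $r$ pairwise independent edges between the leaves, so that it has $r$ triangles (sharing the center) and $t-2r-1$ pendent edges. A $k$-edge-coloring assigns to each edge one of $k$ colors; all $k$-edge-colorings are assumed exact, i.e. each of the $k$ colors is used at least once. An edge-colored graph is rainbow if all its edges have different colors and monochromatic if all its edges have a single color. A copy of a graph means a (not necessarily induced) subgraph isomorphic to it. For non-empty graphs $G,H$ (graphs with at least one edge) and a positive integer $k$, the Gallai-Ramsey number $\operatorname{gr}_k(G:H)$ is the minimum integer $N$ with $\binom{N}{2}\geq k$ (so that $K_N$ admits a $k$-edge-coloring) such that for all $n\geq N$, every $k$-edge-coloring of $K_n$ contains either a rainbow copy of $G$ or a monochromatic copy of $H$. *)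

(* Defs.v *)
From mathcomp Require Import all_boot.

Set Implicit Arguments.
Unset Strict Implicit.
Unset Printing Implicit Defensive.

Record sgraph := SGraph {
  vertex :> finType;
  adj : rel vertex;
  adj_sym : symmetric adj;
  adj_irrefl : irreflexive adj }.

Definition edges (G : sgraph) : {set {set G}} :=
  [set [set x; y] | x in G, y in G & adj x y].

Definition complete_rel n : rel 'I_n := fun x y => x != y.

Lemma complete_rel_sym n : symmetric (@complete_rel n).
Proof. by move=> x y; rewrite /complete_rel eq_sym. Qed.

Lemma complete_rel_irrefl n : irreflexive (@complete_rel n).
Proof. by move=> x; rewrite /complete_rel eqxx. Qed.

Definition complete_graph n : sgraph :=
  SGraph (@complete_rel_sym n) (@complete_rel_irrefl n).

Definition path_rel n : rel 'I_n :=
  fun x y => (x.+1 == y :> nat) || (y.+1 == x :> nat).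

Lemma path_rel_sym n : symmetric (@path_rel n).
Proof. by move=> x y; rewrite /path_rel orbC. Qed.

Lemma path_rel_irrefl n : irreflexive (@path_rel n).
Proof. by move=> x; rewrite /path_rel orbb gtn_eqF. Qed.

(* The path with n vertices and n - 1 edges. *)
Definition path_graph n : sgraph :=
  SGraph (@path_rel_sym n) (@path_rel_irrefl n).

(* Oriented edges of S_t^r: vertex 0 is the center, 1, ..., t - 1 are the
   leaves of the star, and the r independent edges added between leaves are
   {1, 2}, {3, 4}, ..., {2r - 1, 2r}.  This is the intended graph only when
   2r + 1 <= t. *)
Definition star_arc r (x y : nat) : bool :=
  ((x == 0) && (0 < y)) || [exists j : 'I_r, (x == j.*2.+1) && (y == j.*2.+2)].

Definition star_rel t r : rel 'I_t :=
  fun x y => star_arc r x y || star_arc r y x.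

Lemma star_rel_sym t r : symmetric (@star_rel t r).
Proof. by move=> x y; rewrite /star_rel orbC. Qed.

Lemma star_rel_irrefl t r : irreflexive (@star_rel t r).
Proof.
move=> x; rewrite /star_rel orbb /star_arc; apply/negbTE.
rewrite negb_or; apply/andP; split; first by case: (x : nat).
by apply/existsPn => j; apply/negP => /andP[/eqP-> /eqP/n_Sn].
Qed.

Definition star_graph t r : sgraph :=
  SGraph (@star_rel_sym t r) (@star_rel_irrefl t r).

(* The copies of G in H are the images of G under such maps. *)
Definition embedding (G H : sgraph) (f : G -> H) : Prop :=
  injective f /\ {homo f : x y / adj x y}.

(* An edge coloring of K_n with colors 'I_k is given by a function on all sets
   of vertices; only its values on the edges of K_n are ever used. *)
Definition coloring n k := {set complete_graph n} -> 'I_k.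

Definition exact_coloring n k (c : coloring n k) : Prop :=
  forall i : 'I_k, exists2 e, e \in edges (complete_graph n) & c e = i.

Definition has_rainbow_copy n k (c : coloring n k) (G : sgraph) : Prop :=
  exists2 f : G -> complete_graph n, embedding f &
    {in edges G &, injective (fun e : {set G} => c (f @: e))}.

Definition has_monochromatic_copy n k (c : coloring n k) (H : sgraph) : Prop :=
  exists2 f : H -> complete_graph n, embedding f &
    exists i : 'I_k, {in edges H, forall e : {set H}, c (f @: e) = i}.

Definition gallai_ramsey_bound k (G H : sgraph) (N : nat) : Prop :=
  k <= 'C(N, 2) /\
  forall n (c : coloring n k), N <= n -> exact_coloring c ->
    has_rainbow_copy c G \/ has_monochromatic_copy c H.

(* gr_k(G : H) = N; this includes the existence of the minimum. *)
Definition gallai_ramsey_number k (G H : sgraph) (N : nat) : Prop :=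
  gallai_ramsey_bound k G H N /\
  forall M, gallai_ramsey_bound k G H M -> N <= M.

(* Main.v *)
Require Import Defs.
From mathcomp Require Import all_boot zify.

(* Upper bound.  Suppose there is no rainbow P_5 and at least five colours.  If
   some vertex [a] sees at least three colours then, for some vertex [a'],
   K_n - a' is monochromatic: [a'] is the centre of a K_4 in which it sees three
   colours distinct from the single colour of the opposite triangle, and such a
   K_4 forces the colour of all other edges avoiding [a'].  If every vertex sees
   at most two colours, the colour sets of the vertices pairwise intersect, so
   they share a colour [d], and the vertices fall into classes such that all
   edges between different classes have colour [d].  A vertex of a smallest
   class then has enough neighbours in colour [d], and the independent edges
   are found by going cyclically through the other k - 2 classes.

   Lower bound.  Either K_t with a monochromatic K_(t-1) and all other colours
   at the remaining vertex, or K_(t+p-2) with its vertices divided evenly into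
   k - 1 classes, each class having its own colour and one further colour being
   used between classes. *)

Set Implicit Arguments.
Unset Strict Implicit.
Unset Printing Implicit Defensive.

(** * Tactics for passing between boolean distinctness conditions and disequalities *)

Ltac split_neq :=
  repeat match goal with
  | H : is_true (_ && _) |- _ =>
      let H1 := fresh in let H2 := fresh in case/andP: H => H1 H2
  | H : is_true (~~ (_ == _)) |- _ => move/eqP: H => H
  | H : is_true (~~ (_ || _)) |- _ => rewrite !negb_or in H
  | H : is_true (~~ (_ \in _)) |- _ => rewrite !inE ?negb_or in H
  | H : is_true (uniq _) |- _ => rewrite /= in H
  end.

Ltac join_neq :=
  rewrite ?(cons_uniq, inE, negb_or) /= ?andbT;
  repeat (apply/andP; split); apply/eqP; congruence.

Ltac solve_neq := split_neq; (congruence || join_neq).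

(** * Edge colourings without rainbow P_5, as symmetric functions of two vertices *)

Section RainbowPathFree.

Variables (V C : finType) (c : V -> V -> C).
Hypothesis cC : forall x y, c x y = c y x.

Definition rainbow_P5_free : Prop := forall x y z u v,
  uniq [:: x; y; z; u; v] -> ~~ uniq [:: c x y; c y z; c z u; c u v].

Definition mono_off a g : Prop :=
  forall u v, u != a -> v != a -> u != v -> c u v = g.

Hypothesis Fc : rainbow_P5_free.

(** All six possible coincidences among the four colours of a path, in a propositional form that
    [congruence] can use. *)
Lemma rainbow_P5_free_cases x y z u v :
  x <> y -> x <> z -> x <> u -> x <> v -> y <> z -> y <> u -> y <> v ->
  z <> u -> z <> v -> u <> v ->
  [\/ c x y = c y z \/ c x y = c z u, c x y = c u v,
      c y z = c z u \/ c y z = c u v | c z u = c u v].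
Proof.
do 10 move/eqP/negbTE=> ?; have := @Fc x y z u v.
rewrite /= !inE !negb_or.
do 10 (match goal with H : (_ == _) = false |- _ => rewrite H; clear H end).
move=> /(_ isT); rewrite andbT !negb_and !negbK.
case/or3P => [/or3P[]|/orP[]|] /eqP ->.
- by apply: Or41; left.
- by apply: Or41; right.
- by apply: Or42.
- by apply: Or43; left.
- by apply: Or43; right.
by apply: Or44.
Qed.

(** Branches that [congruence] cannot refute keep their equation for the next path in a chain of
    calls. *)
Ltac no_rainbow x y z u v :=
  pose proof (cC x y); pose proof (cC y z); pose proof (cC z u);
  pose proof (cC u v);
  destruct (@rainbow_P5_free_cases x y z u v) as [[?|?]|?|[?|?]|?];
  try congruence.

(** For a colour of [w x] other than [g], the paths [w x y a z], [w x a y z] and [w x a z y] each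
    allow only two of the three colours from [a] to the triangle, a different two each time. *)
Lemma mono_ext g a x y z w :
  a \notin [:: x; y; z; w] -> uniq [:: c a x; c a y; c a z; g] ->
  c x y = g -> c y z = g -> c x z = g -> w \notin [:: x; y; z] -> c w x = g.
Proof.
move=> *; split_neq; case: (c w x =P g) => // ?; exfalso.
by no_rainbow w x y a z; no_rainbow w x z a y; no_rainbow w x a y z;
  no_rainbow w x a z y.
Qed.

Lemma tetra_mono_off g a x y z :
  a \notin [:: x; y; z] -> uniq [:: c a x; c a y; c a z; g] ->
  c x y = g -> c y z = g -> c x z = g -> mono_off a g.
Proof.
move=> axyz col xy yz xz.
have ext w : w != a -> w \notin [:: x; y; z] ->
    [/\ c w x = g, c w y = g & c w z = g].
  move=> wa wxyz; have := cC x y; have := cC y z; have := cC x z.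
  split_neq=> *; split.
  - by apply: (@mono_ext g a x y z w) => //; join_neq.
  - by apply: (@mono_ext g a y z x w); rewrite //; solve_neq.
  by apply: (@mono_ext g a z x y w); rewrite //; solve_neq.
have mem u v : u != a -> u != v -> v \in [:: x; y; z] -> c u v = g.
  move=> ua uv vxyz; have [uxyz|] := boolP (u \in [:: x; y; z]); last first.
    by case/ext=> //; move: vxyz; rewrite !inE => /or3P[] /eqP->.
  move: uxyz vxyz uv; rewrite !inE => /or3P[] /eqP-> /or3P[] /eqP->;
    by rewrite ?eqxx // cC.
move=> u v ua va uv; have [|vxyz] := boolP (v \in [:: x; y; z]).
  exact: mem.
have [|uxyz] := boolP (u \in [:: x; y; z]).
  by rewrite cC; apply: mem; rewrite // eq_sym.
have [ux uy uz] := ext u ua uxyz; split_neq.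
(* Both [u x] and [u y] have colour [g], so each of the three paths allows [c u v] only two of the
   colours from [a] to the triangle; none survives all three. *)
case: (c u v =P g) => // ?; exfalso.
by no_rainbow v u x a y; no_rainbow v u x a z; no_rainbow v u y a z.
Qed.

(** * Vertices seeing four or more colours; an edge is foreign if its colour is not among those
    considered at the vertex *)

Definition exists_mono_off : Prop := exists a g, mono_off a g.

(** The edge [z u] is forced to share the colour of [x y], then so are [y z] and [x z]; now [a] and
    the triangle [x y z] form the K_4 of [tetra_mono_off]. *)
Lemma four_colors_foreign_edge a x y z u :
  a \notin [:: x; y; z; u] ->
  uniq [:: c a x; c a y; c a z; c a u] ->
  c x y \notin [:: c a x; c a y; c a z; c a u] -> exists_mono_off.
Proof.
move=> aE col xyE; exists a, (c x y).
suff [yz xz] : c y z = c x y /\ c x z = c x y.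
  by split_neq; apply: (@tetra_mono_off _ a x y z) => //; join_neq.
split_neq.
have zu : c z u = c x y.
  case: (c z u =P c x y) => // ?; exfalso.
  no_rainbow y x a z u; no_rainbow y x a u z; no_rainbow x y a z u.
split.
- case: (c y z =P c x y) => // ?; exfalso.
  no_rainbow u a x y z; no_rainbow x a u z y;
  no_rainbow z a y x u; no_rainbow y a z u x;
  no_rainbow u x a z y; no_rainbow x u a z y; no_rainbow u x a y z;
  no_rainbow x u a y z.
- case: (c x z =P c x y) => // ?; exfalso.
  no_rainbow u a y x z; no_rainbow y a u z x;
  no_rainbow z a x y u; no_rainbow x a z u y;
  no_rainbow u y a z x; no_rainbow y u a z x; no_rainbow u y a x z;
  no_rainbow y u a x z.
Qed.

Lemma five_colors_edge a x y z u v :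
  a \notin [:: x; y; z; u; v] ->
  uniq [:: c a x; c a y; c a z; c a u; c a v] ->
  exists_mono_off \/ (c x y == c a x) || (c x y == c a y).
Proof.
move=> aE col; have [xE|] := boolP (_ || _); [by right | left].
(* At most one of [z], [u], [v] is joined to [a] in the colour of [x y]; omitting it leaves four
   colours to which [x y] is foreign. *)
have [xz|?] := eqVneq (c x y) (c a z).
  by apply: (@four_colors_foreign_edge a x y u v); solve_neq.
have [xu|?] := eqVneq (c x y) (c a u).
  by apply: (@four_colors_foreign_edge a x y z v); solve_neq.
by apply: (@four_colors_foreign_edge a x y z u); solve_neq.
Qed.

(* By the previous lemma, two disjoint edges among five differently coloured
   neighbours of [a] extend, through [a], to a rainbow path. *)
Lemma five_colors_mono_off a x y z u v :
  a \notin [:: x; y; z; u; v] ->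
  uniq [:: c a x; c a y; c a z; c a u; c a v] -> exists_mono_off.
Proof.
move=> aE col; have [//|xy] := five_colors_edge aE col.
have [||//|zu] := @five_colors_edge a z u x y v; try by solve_neq.
exfalso; split_neq; case/orP: xy => /eqP ?; case/orP: zu => /eqP ?.
- by no_rainbow x y a u z.
- by no_rainbow x y a z u.
- by no_rainbow y x a u z.
by no_rainbow y x a z u.
Qed.

(** Covers a foreign edge [u w] whose ends have the same colour to [a] and so cannot supply two of
    four colours. Unless [x y] or [u x] is itself foreign, [x y] gets the colour [c a u], and then
    every colour left for [u x] gives a rainbow path. *)
Lemma foreign_edge_same_color a x y z u w :
  a \notin [:: x; y; z; u; w] -> u != w -> c a w = c a u ->
  uniq [:: c a x; c a y; c a z; c a u; c u w] -> exists_mono_off.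
Proof.
move=> aE uw awu col.
have [|xyE] := boolP (c x y \notin [:: c a x; c a y; c a z; c a u]).
  by apply: four_colors_foreign_edge; solve_neq.
have [|uxE] := boolP (c u x \notin [:: c a u; c a x; c a y; c a z]).
  by apply: four_colors_foreign_edge; solve_neq.
move: xyE uxE; rewrite !negbK !inE => xyE uxE; exfalso; split_neq.
have xy : c x y = c a u.
  by case/or4P: xyE => /eqP // ?; exfalso;
    no_rainbow w u a x y; no_rainbow w u a y x.
case/or4P: uxE => /eqP ?.
- by no_rainbow w u x a y; no_rainbow w u x a z.
- by no_rainbow w u x y a.
- by no_rainbow w u x a z.
by no_rainbow w u x a y.
Qed.

Definition colors_at a : {set C} := [set c a v | v in predC1 a].

(** One neighbour is chosen per colour; removing colours already in use from [A] makes the new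
    neighbours differ from the earlier ones. *)
Lemma color_leaves a (A : {set C}) m :
  A \subset colors_at a -> m <= #|A| ->
  exists s : seq V,
    [/\ size s = m, a \notin s, uniq (map (c a) s) & {subset map (c a) s <= A}].
Proof.
move=> /subsetP sA /card_geqP[t [ut <- tA]].
have tP i : i \in t -> exists2 v, v != a & c a v = i.
  by move/tA/sA/imsetP=> [v]; rewrite inE => va ->; exists v.
have [s [at_s ts]] : exists s, a \notin s /\ map (c a) s = t.
  elim: t tP {ut tA} => [_|i t IHt tP]; first by exists [::].
  have [v va vi] := tP i (mem_head i t).
  have [|s [as_ <-]] := IHt; first by move=> j jt; apply: tP;
    rewrite inE jt orbT.
  by exists (v :: s); rewrite inE negb_or eq_sym va as_ /= vi.
by exists s; rewrite ts -(size_map (c a)) ts.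
Qed.


Lemma colors_at_edge u v : u != v -> c u v \in colors_at u.
Proof. by move=> uv; apply: imset_f; rewrite inE eq_sym. Qed.

Lemma foreign_edge_off a u w :
  u != w -> c u w \notin colors_at a -> a \notin [:: u; w].
Proof.
move=> uw; apply: contra; rewrite !inE => /orP[] /eqP->.
  exact: colors_at_edge.
by rewrite cC colors_at_edge // eq_sym.
Qed.

Lemma foreign_color a i v : i \notin colors_at a -> v != a -> c a v != i.
Proof. by move=> ia va; apply: contraNneq ia => <-; apply: imset_f. Qed.

Lemma four_colors_mono_off a u w :
  3 < #|colors_at a| -> u != w -> c u w \notin colors_at a -> exists_mono_off.
Proof.
move=> card_a uw uwE; have := foreign_edge_off uw uwE; rewrite !inE negb_or.
case/andP=> au aw; have uE := colors_at_edge au; have wE := colors_at_edge aw.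
have ma v : v != a -> c a v != c u w := foreign_color uwE.
(* If both ends of [u w] have one colour to [a], three further colours are picked; otherwise the
   ends supply two colours and two more are picked. *)
have [awu|awu] := eqVneq (c a w) (c a u).
  have [|[|x [|y [|z [|? ?]]]] [//= _ asx us sA]] :=
      @color_leaves a (colors_at a :\ c a u) 3 (subsetDl _ _).
    by rewrite (cardsD1 (c a u)) uE in card_a.
  have cu v : v \in [:: x; y; z] -> c a v != c a u.
    by move/(map_f (c a))/sA; rewrite !inE => /andP[].
  have := cu x; have := cu y; have := cu z.
  rewrite !inE !eqxx !orbT => /(_ isT) zu /(_ isT) yu /(_ isT) xu.
  have := ma u; have := ma x; have := ma y; have := ma z.
  rewrite ![_ == a]eq_sym => mz my mx mu.
  move: (asx); rewrite !inE !negb_or => /and3P[/mx ? /my ? /mz ?].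
  have ? := mu au.
  by apply: (@foreign_edge_same_color a x y z u w) => //; solve_neq.
have sub : colors_at a :\ c a u :\ c a w \subset colors_at a.
  by rewrite setDDl subsetDl.
have [|[|x [|y [|? ?]]] [//= _ asx us sA]] := @color_leaves a _ 2 sub.
  rewrite (cardsD1 (c a u)) uE (cardsD1 (c a w)) in card_a.
  by move: card_a; rewrite !inE awu wE.
have cu v : v \in [:: x; y] -> (c a v != c a w) && (c a v != c a u).
  by move/(map_f (c a))/sA; rewrite !inE => /and3P[-> ->].
have := cu x; have := cu y.
rewrite !inE !eqxx !orbT => /(_ isT) ? /(_ isT) ?.
have := ma u; have := ma x; have := ma y; have := ma w.
rewrite ![_ == a]eq_sym => mw my mx mu.
move: (asx); rewrite !inE !negb_or => /andP[/mx ? /my ?].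
have ? := mu au; have ? := mw aw.
by apply: (@four_colors_foreign_edge a u w x y); solve_neq.
Qed.

(** * Vertices seeing three colours, with two foreign colours elsewhere *)

Lemma foreign_edges_triangle a x y z v :
  uniq [:: a; x; y; z; v] -> uniq [:: c a x; c a y; c a z; c x y; c x z] ->
  False.
Proof.
move=> *; split_neq.
(* Together the three paths leave no colour for the edge [y v]. *)
by no_rainbow z x a y v; no_rainbow x z a y v; no_rainbow z a x y v.
Qed.

Hypothesis V_gt4 : 4 < #|V|.

Lemma exists_fifth (a x y z : V) : exists v, v \notin [:: a; x; y; z].
Proof.
apply/existsP; rewrite -negb_forall; apply/negP => /forallP all_in.
suff: #|V| <= size [:: a; x; y; z] by move=> /(leq_trans V_gt4).
by apply: leq_trans (card_size _); apply: subset_leq_card; apply/subsetP.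
Qed.

Lemma foreign_edges_adjacent a u w q z :
  a \notin [:: u; w; q; z] -> uniq [:: u; w; q] ->
  uniq [:: c a u; c a w; c a z] ->
  c u w \notin colors_at a -> c u q \notin colors_at a -> c u w <> c u q ->
  False.
Proof.
move=> aE uE cE /foreign_color uwE /foreign_color uqE ne.
have [v vE] := exists_fifth a u w q.
have ne_a t : a <> t -> c a t <> c u w /\ c a t <> c u q.
  by move/nesym/eqP=> ta; split; apply/eqP; auto.
split_neq.
have [//|? ?] := ne_a u; have [//|? ?] := ne_a w; have [//|? ?] := ne_a q.
have [//|? ?] := ne_a z.
(* The vertices [z] and [q] may coincide. If [c a q] repeats the colour of [a u] or [a w], they do
   not, and [z a w u q] is rainbow; otherwise the triangle lemma applies with [q] itself. *)
have [aqu|aqu] := eqVneq (c a q) (c a u).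
  by no_rainbow z a w u q.
have [aqw|aqw] := eqVneq (c a q) (c a w).
  by no_rainbow z a w u q.
by apply: (@foreign_edges_triangle a u w q v); solve_neq.
Qed.

(** Disjoint foreign edges are linked through [a] and [p] from an end of [u w] whose colour to [a]
    differs from [c a p]; a shared vertex is the adjacent case. *)
Lemma foreign_edge_ends a u w p q z :
  a \notin [:: u; w; p; q; z] -> u <> w -> p <> q ->
  uniq [:: c a u; c a w; c a z] ->
  c u w \notin colors_at a -> c p q \notin colors_at a -> c u w <> c p q ->
  False.
Proof.
move=> aE uw pq cE uwE pqE ne.
have uwE' := uwE; rewrite cC in uwE'; have pqE' := pqE; rewrite cC in pqE'.
have ne_a t : a <> t -> c a t <> c u w /\ c a t <> c p q.
  by move/nesym/eqP=> ta; split; apply/eqP; apply: foreign_color.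
have := cC u w; have := cC p q; move=> cpq cuw.
have [pu|pu] := eqVneq p u.
  subst p; apply: (@foreign_edges_adjacent a u w q z) => //; solve_neq.
have [pw|pw] := eqVneq p w.
  by subst p; apply: (@foreign_edges_adjacent a w u q z) => //; solve_neq.
have [qu|qu] := eqVneq q u.
  by subst q; apply: (@foreign_edges_adjacent a u w p z) => //; solve_neq.
have [qw|qw] := eqVneq q w.
  by subst q; apply: (@foreign_edges_adjacent a w u p z) => //; solve_neq.
split_neq.
have [//|? ?] := ne_a u; have [//|? ?] := ne_a w; have [//|? ?] := ne_a p.
have [apu|apu] := eqVneq (c a p) (c a u).
  by no_rainbow u w a p q.
by split_neq; no_rainbow w u a p q.
Qed.

Lemma foreign_edges_same_color a u w p q y z :
  a \notin [:: u; w; p; q; y; z] -> u <> w -> p <> q ->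
  uniq [:: c a u; c a y; c a z; c u w; c p q] ->
  c a w = c a u -> c a p = c a u -> c a q = c a u -> False.
Proof.
have adjacent r s t : a \notin [:: r; s; t; y; z] ->
    uniq [:: c a r; c a y; c a z; c r s; c r t] -> s <> t ->
    r <> s -> r <> t ->
    c a s = c a r -> c a t = c a r -> False.
  by move=> *; split_neq; no_rainbow y a s r t.
move=> aE uw pq cE aw ap aq; have := cC u w; have := cC p q; move=> cpq cuw.
have [pu|pu] := eqVneq p u.
  by subst p; apply: (@adjacent u w q) => //; solve_neq.
have [pw|pw] := eqVneq p w.
  by subst p; apply: (@adjacent w u q) => //; solve_neq.
have [qu|qu] := eqVneq q u.
  by subst q; apply: (@adjacent u w p) => //; solve_neq.
have [qw|qw] := eqVneq q w.
  by subst q; apply: (@adjacent w u p) => //; solve_neq.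
split_neq.
(* For disjoint edges, the colours of [u p], [q y] and [w y] are forced in turn, after which
   [z a w y q] has the distinct colours of [a z], [a u], [u w] and [p q]. *)
have up : c u p = c a u.
  case: (c u p =P c a u) => // ?; exfalso.
  by no_rainbow y a w u p; no_rainbow z a w u p; no_rainbow y a q p u.
have qy : c q y = c p q.
  case: (c q y =P c p q) => // ?; exfalso.
  by no_rainbow z a p q y; no_rainbow z a y q p; no_rainbow w u p q y.
have wy : c w y = c u w.
  case: (c w y =P c u w) => // ?; exfalso.
  by no_rainbow z a u w y; no_rainbow z a y w u; no_rainbow q p u w y.
by no_rainbow z a w y q.
Qed.

(** Each foreign edge has one colour from [a] to both its ends, by [foreign_edge_ends]; the two
    edges share that colour, or [w u a p q] is rainbow; two further colours at [a] then contradict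
    [foreign_edges_same_color]. *)
Lemma two_foreign_colors a u w p q :
  2 < #|colors_at a| -> u != w -> p != q ->
  c u w \notin colors_at a -> c p q \notin colors_at a ->
  c u w != c p q -> False.
Proof.
move=> card_a uw pq uwE pqE ne.
have := foreign_edge_off uw uwE; have := foreign_edge_off pq pqE.
rewrite !inE !negb_or => /andP[ap aq] /andP[au aw].
have ends r s t v : a != r -> a != s -> a != t -> a != v -> r != s -> t != v ->
    c r s \notin colors_at a -> c t v \notin colors_at a -> c r s != c t v ->
    c a r = c a s.
  move=> ar as_ at_ av rs tv rsE tvE ne'; case: (c a r =P c a s) => // rsa.
  have sub : colors_at a :\ c a r :\ c a s \subset colors_at a.
    by rewrite setDDl subsetDl.
  have [|[|z [|? ?]] [//= _ az _ sA]] := @color_leaves a _ 1 sub.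
    rewrite (cardsD1 (c a r)) colors_at_edge // (cardsD1 (c a s)) in card_a.
    by move: card_a; rewrite !inE eq_sym colors_at_edge // andbT;
      move/eqP: rsa => ->.
  have := sA _ (mem_head _ _); rewrite !inE => /and3P[? ? _].
  by case: (@foreign_edge_ends a r s t v z) => //; solve_neq.
have auw : c a u = c a w by apply: (@ends u w p q).
have apq : c a p = c a q by apply: (@ends p q u w) => //; rewrite eq_sym.
have [pu|pu] := eqVneq (c a p) (c a u); last first.
  have fu := foreign_color uwE; have fp := foreign_color pqE.
  have := fu u; have := fp u; have := fu p; have := fp p.
  rewrite ![_ == a]eq_sym => /(_ ap) ? /(_ ap) ? /(_ au) ? /(_ au) ?.
  by split_neq; no_rainbow w u a p q.
have [|[|y [|z [|? ?]]] [//= _ ayz us sA]] :=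
    @color_leaves a (colors_at a :\ c a u) 2 (subsetDl _ _).
  by rewrite (cardsD1 (c a u)) colors_at_edge in card_a.
have := sA (c a y); have := sA (c a z); rewrite !inE !eqxx !orbT.
move=> /(_ isT)/andP[zu zE] /(_ isT)/andP[yu yE].
have ne_a r s : c r s \notin colors_at a -> c a u != c r s /\ c a y != c r s /\
    c a z != c r s.
  move=> rsE; split; last split; apply: contraNneq rsE => <- //.
  exact: colors_at_edge.
have [? [? ?]] := ne_a u w uwE; have [? [? ?]] := ne_a p q pqE.
by apply: (@foreign_edges_same_color a u w p q y z); solve_neq.
Qed.

(** * The dichotomy, and the dominant colour when every vertex sees at most two *)

Lemma mono_off_or_two_colors :
  4 < #|C| -> (forall i, exists u v, u != v /\ c u v = i) ->
  exists_mono_off \/ forall a, #|colors_at a| <= 2.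
Proof.
move=> C_gt4 c_onto.
have [/existsP[a a_gt2]|/existsPn a_le2] :=
    boolP [exists a, 2 < #|colors_at a|]; last first.
  by right=> a; rewrite leqNgt a_le2.
(* At least five colours in total leave one foreign colour when [a] sees four, and two when it sees
   three. *)
left; have [a_gt4|a_le4] := ltnP 4 #|colors_at a|.
  have [s [sz as_ us _]] := color_leaves (subxx _) a_gt4.
  case: s sz as_ us => [|x [|y [|z [|u [|v [|? ?]]]]]] // _.
  exact: five_colors_mono_off.
have card_compl := cardsC (colors_at a).
have [a_gt3|a_le3] := ltnP 3 #|colors_at a|.
  have /card_gt0P[i] : 0 < #|~: colors_at a| by lia.
  rewrite inE; have [u [v [uv <-]]] := c_onto i.
  exact: four_colors_mono_off.
have /card_gt1P[i [j []]] : 1 < #|~: colors_at a| by lia.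
rewrite !inE; have [u [v [uv <-]]] := c_onto i.
have [p [q [pq <-]]] := c_onto j.
by move=> *; case: (@two_foreign_colors a u v p q).
Qed.

(* Two sets of colours [colors_at u] and [colors_at v] always share [c u v], and
   a pairwise intersecting family of sets of size at most two is a star or a
   triangle; the latter would allow three colours only. *)
Lemma common_color :
  4 < #|C| -> (forall i, exists u v, u != v /\ c u v = i) ->
  (forall a, #|colors_at a| <= 2) -> exists d, forall v, d \in colors_at v.
Proof.
move=> C_gt4 c_onto le2.
have meet u v : exists2 i, i \in colors_at u & i \in colors_at v.
  have [<-|uv] := eqVneq u v.
    have [] := @exists_fifth u u u u => v0;
      rewrite !inE !negb_or => /andP[v0u _].
    by exists (c u v0); apply: colors_at_edge; rewrite eq_sym.
  exists (c u v); first exact: colors_at_edge.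
  by rewrite cC colors_at_edge // eq_sym.
have sub2 v i j : i != j -> i \in colors_at v -> j \in colors_at v ->
    colors_at v = [set i; j].
  move=> ij iv jv; apply/esym/eqP; rewrite eqEcard cards2 ij le2 andbT.
  by apply/subsetP=> x; rewrite !inE => /orP[] /eqP->.
have [/existsP[d /forallP dP]|/existsPn no_d] :=
    boolP [exists d, [forall v, d \in colors_at v]]; first by exists d.
exfalso.
have avoid d : exists v, d \notin colors_at v.
  by apply/existsP; rewrite -negb_forall.
have /card_gt0P[v _] : 0 < #|V| by apply: leq_trans V_gt4.
have [d1 d1v _] := meet v v; have [w d1w] := avoid d1.
have [d2 d2v d2w] := meet v w; have [x d2x] := avoid d2.
have [m mw mx] := meet w x; have [d1' d1'v d1'x] := meet v x.
have d12 : d1 != d2 by apply: contraNneq d1w => ->.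
have d1m : d1 != m by apply: contraNneq d1w => ->.
have d2m : d2 != m by apply: contraNneq d2x => ->.
have vE := sub2 v _ _ d12 d1v d2v; have wE := sub2 w _ _ d2m d2w mw.
have d1x : d1 \in colors_at x.
  by move: d1'v d1'x; rewrite vE !inE => /orP[] /eqP-> //;
    rewrite (negbTE d2x).
have xE := sub2 x _ _ d1m d1x mx.
have [j] : exists j, j \notin [:: d1; d2; m].
  apply/existsP; rewrite -negb_forall; apply/negP => /forallP all_in.
  suff: #|C| <= size [:: d1; d2; m] by move=> /(leq_trans C_gt4).
  by apply: leq_trans (card_size _); apply: subset_leq_card; apply/subsetP.
rewrite !inE !negb_or => /and3P[jd1 jd2 jm].
have [u [u' [uu' cj]]] := c_onto j.
have ju : j \in colors_at u by rewrite -cj colors_at_edge.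
have [e1 e1u e1v] := meet u v; have [e2 e2u e2w] := meet u w.
have [e3 e3u e3x] := meet u x.
have je1 : j != e1 by apply: contraTneq e1v => <-; rewrite vE !inE negb_or jd1.
have je2 : j != e2 by apply: contraTneq e2w => <-; rewrite wE !inE negb_or jd2.
have je3 : j != e3 by apply: contraTneq e3x => <-; rewrite xE !inE negb_or jd1.
have uE := sub2 u _ _ je1 ju e1u.
move: e2u e3u; rewrite uE !inE !(eq_sym _ j) (negbTE je2) (negbTE je3) /=.
move=> /eqP e21 /eqP e31; move: e1v e2w e3x; rewrite e21 e31 vE wE xE !inE.
by case/orP=> /eqP->; rewrite ?(negbTE d12) ?(negbTE d1m) ?(negbTE d2m) //
  eq_sym (negbTE d12).
Qed.

(** The class [f v] is the colour other than [d] at [v], with default [d] where [v] sees only [d].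
    An edge colour must occur at both ends, so a colour other than [d] lives inside its class. *)
Lemma dominant_color :
  4 < #|C| -> (forall i, exists u v, u != v /\ c u v = i) ->
  (forall a, #|colors_at a| <= 2) ->
  exists d (f : V -> C),
    (forall u v, u != v -> (f u != f v) || (f u == d) -> c u v = d) /\
    forall i, i != d -> exists u v, [/\ u != v, f u = i & f v = i].
Proof.
move=> C_gt4 c_onto le2; have [d dP] := common_color C_gt4 c_onto le2.
pose f v := odflt d [pick i in colors_at v :\ d].
have fP v i : i \in colors_at v -> i = d \/ i = f v.
  move=> iv; have [-> |id] := eqVneq i d; [by left | right].
  rewrite /f; case: pickP => [j|/(_ i)]; last by rewrite !inE id iv.
  rewrite !inE => /andP[jd jv]; apply: contraTeq (le2 v) => ij; rewrite -ltnNge.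
  by rewrite (cardsD1 d) dP (cardsD1 j) (cardsD1 i) !inE jd jv /= ij id iv.
have fE u v : u != v -> (c u v = d \/ c u v = f u) /\
    (c u v = d \/ c u v = f v).
  move=> uv; split; apply: fP; first exact: colors_at_edge.
  by rewrite cC colors_at_edge // eq_sym.
exists d, f; split=> [u v uv|i id].
  have [[//|uE] [//|vE]] := fE u v uv.
  by rewrite -uE vE eqxx /= => /eqP.
(* Both ends of an edge of colour [i] lie in class [i]. *)
have [u [v [uv ci]]] := c_onto i; exists u, v.
by have [[] uE [] vE] := fE u v uv; split=> //; move: id;
  rewrite -?uE -?vE -ci ?uE ?vE ?eqxx.
Qed.

End RainbowPathFree.

(** * Copies of P_5 and of the star in a coloured complete graph *)

Lemma edges_path m (e : {set path_graph m.+1}) :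
  reflect (exists2 i, i < m & e = [set inord i; inord i.+1])
          (e \in edges (path_graph m.+1)).
Proof.
apply: (iffP imset2P) => [[x y _]|[i im ->]].
  rewrite !inE /= => /orP[] /eqP E ->; [exists x | exists y]; last 1 first.
  - by rewrite setUC E !inord_val.
  - by have := ltn_ord y; lia.
  - by rewrite E !inord_val.
  by have := ltn_ord x; lia.
exists (inord i) (inord i.+1); rewrite ?inE //=.
by rewrite /path_rel !inordK ?eqxx // ltnW.
Qed.

Lemma imset_set2 (aT rT : finType) (f : aT -> rT) x y :
  f @: [set x; y] = [set f x; f y].
Proof. by rewrite imsetU1 imset_set1. Qed.

Lemma has_rainbow_P5 n k (c : coloring n k) x y z u v :
  uniq [:: x; y; z; u; v] ->
  uniq [:: c [set x; y]; c [set y; z]; c [set z; u]; c [set u; v]] ->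
  has_rainbow_copy c (path_graph 5).
Proof.
set s := [:: x; _; _; _; _] => us; set t := [:: _; _; _; _] => ut.
have fE (i : 'I_5) : i < size s := ltn_ord i.
have f_inj : injective (fun i : path_graph 5 => nth x s (i : 'I_5)).
  by move=> i j /eqP; rewrite nth_uniq // => /eqP/val_inj.
exists (fun i : path_graph 5 => nth x s (i : 'I_5)).
  split=> // i j /=; rewrite /complete_rel (inj_eq f_inj) => ij.
  by apply: contraTneq ij => ->; rewrite path_rel_irrefl.
move=> _ _ /edges_path[i i4 ->] /edges_path[j j4 ->].
have colE l : l < 4 -> c ((fun i : path_graph 5 => nth x s (i : 'I_5)) @:
    [set inord l; inord l.+1]) = nth (c [set x; y]) t l.
  move=> l4; rewrite imset_set2 !inordK ?ltnS // 1?ltnW //.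
  by case: l l4 => [|[|[|[|?]]]].
by rewrite !colE // => /eqP; rewrite nth_uniq // => /eqP->.
Qed.

Lemma rainbow_P5_or_free n k (c : coloring n k) :
  has_rainbow_copy c (path_graph 5) \/
  rainbow_P5_free (fun x y => c [set x; y]).
Proof.
have [/existsP[x /existsP[y /existsP[z /existsP[u /existsP[v]]]]]|nE] :=
  boolP [exists x, exists y, exists z, exists u, exists v,
    uniq [:: x; y; z; u; v] &&
    uniq [:: c [set x; y]; c [set y; z]; c [set z; u]; c [set u; v]]].
  by case/andP=> us ut; left; apply: has_rainbow_P5 us ut.
right=> x y z u v us; apply: contra nE => ut.
apply/existsP; exists x; apply/existsP; exists y; apply/existsP; exists z.
by apply/existsP; exists u; apply/existsP; exists v; rewrite us.
Qed.

Lemma rainbow_P5_free_no_copy n k (c : coloring n k)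
    (h : 'I_n -> 'I_n -> 'I_k) :
  (forall x y, x != y -> c [set x; y] = h x y) -> rainbow_P5_free h ->
  ~ has_rainbow_copy c (path_graph 5).
Proof.
move=> ch Fh [f [f_inj _] c_inj].
pose s := [seq f (inord i) | i <- iota 0 5].
have us : uniq s.
  rewrite map_inj_in_uniq ?iota_uniq // => i j; rewrite !mem_iota => /= i5 j5.
  by move=> /f_inj/(congr1 val); rewrite /= !inordK.
have := Fh _ _ _ _ _ us; apply/negP; rewrite negbK.
have hE : {in iota 0 4, forall i, h (f (inord i)) (f (inord i.+1)) =
    c (f @: [set inord i; inord i.+1])}.
  move=> i; rewrite mem_iota => /= i4; rewrite imset_set2 ch // (inj_eq f_inj).
  by rewrite -val_eqE /= !inordK //; lia.
rewrite -[X in uniq X]/[seq h (f (inord i)) (f (inord i.+1)) | i <- iota 0 4].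
rewrite (proj1 (eq_in_map _ _ _) hE) map_inj_in_uniq ?iota_uniq // => i j.
rewrite !mem_iota => /= i4 j4 /c_inj E.
have {E} /setP E : [set inord i; inord i.+1] =
    [set inord j; inord j.+1] :> {set path_graph 5}.
  by apply: E; apply/edges_path; [exists i | exists j].
have := E (inord i); have := E (inord i.+1).
rewrite !inE -!val_eqE /= !inordK //; lia.
Qed.

(** The centre goes to [v] and leaf [i] to entry [i - 1] of [s], so the added edge on leaves
    [2j + 1], [2j + 2] sits at positions [2j], [2j + 1]. *)
Lemma mono_star_copy n k (c : coloring n k) t r v (s : seq 'I_n) d :
  0 < t -> t <= (size s).+1 -> uniq (v :: s) ->
  {in s, forall x, c [set v; x] = d} ->
  (forall j, j < r -> c [set nth v s j.*2; nth v s j.*2.+1] = d) ->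
  has_monochromatic_copy c (star_graph t r).
Proof.
case: t => // t _ st us cs cm.
have f_inj : injective (fun i : star_graph t.+1 r =>
    nth v (v :: s) (i : 'I_t.+1)).
  move=> i j /eqP; rewrite nth_uniq // ?(leq_trans (ltn_ord _)) //.
  by move=> /eqP/val_inj.
exists (fun i : star_graph t.+1 r => nth v (v :: s) (i : 'I_t.+1)).
  split=> // i j /=; rewrite /complete_rel (inj_eq f_inj) => ij.
  by apply: contraTneq ij => ->; rewrite star_rel_irrefl.
exists d => _ /imset2P[x y _ + ->]; rewrite inE /= => xy; rewrite imset_set2.
wlog {xy} : x y / star_arc r x y.
  by move=> W; case/orP: xy => [/W //|/W]; rewrite setUC.
case/orP=> [/andP[/eqP-> y0]|/existsP[j /andP[/eqP-> /eqP->]]].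
  rewrite /=; case: y y0 => -[|y] //= yt _; apply: cs; apply: mem_nth.
  by rewrite -ltnS (leq_trans yt).
exact: cm.
Qed.

Lemma mono_star_embedding n k (c : coloring n k)
    (h : 'I_n -> 'I_n -> 'I_k) t r :
  (forall x y, x != y -> c [set x; y] = h x y) ->
  has_monochromatic_copy c (star_graph t r) ->
  exists (f : 'I_t -> 'I_n) i, injective f /\
    forall x y, star_rel r x y -> h (f x) (f y) = i.
Proof.
move=> ch [f [f_inj _] [i ci]]; exists f, i; split=> // x y xy.
rewrite -ch; last first.
  by rewrite (inj_eq f_inj); apply: contraTneq xy => ->;
    rewrite star_rel_irrefl.
by rewrite -imset_set2; apply: ci; apply/imset2P; exists x y; rewrite ?inE.
Qed.

Lemma exists_coloring n k (h : 'I_n -> 'I_n -> 'I_k) :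
  0 < k -> (forall x y, h x y = h y x) ->
  exists c : coloring n k, forall x y, x != y -> c [set x; y] = h x y.
Proof.
case: k h => // k h _ hC.
(* Symmetry of [h] makes the picked orientation irrelevant; sets that are not edges get the default
   [ord0]. *)
pose c (e : {set complete_graph n}) :=
  if [pick p : 'I_n * 'I_n | (p.1 != p.2) && (e == [set p.1; p.2])] is Some p
  then h p.1 p.2 else ord0.
exists c => x y xy; rewrite /c;
  case: pickP => [[u v] /= /andP[uv /eqP E]|/(_ (x, y))].
  have := set21 x y; have := set22 x y; rewrite E !inE.
  move=> yE xE; move: xy; case/orP: yE => /eqP->; case/orP: xE => /eqP->;
    by rewrite ?eqxx // hC.
by rewrite /= xy eqxx.
Qed.

(** * Upper bound: monochromatic stars in both structures *)

Lemma mono_off_star n k (c : coloring n k) t r :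
  0 < t < n -> r.*2 < t ->
  exists_mono_off (fun x y => c [set x; y]) ->
  has_monochromatic_copy c (star_graph t r).
Proof.
case/andP=> t0 tn rt [a [g mono]].
have card_s : size (enum (predC1 a)) = n.-1 by rewrite -cardE cardC1 card_ord.
case E : (enum (predC1 a)) card_s => [|v s] /= card_s; first by lia.
have us : uniq (v :: s) by rewrite -E enum_uniq.
have sa : {in v :: s, forall x, x != a} by move=> x; rewrite -E mem_enum.
apply: (@mono_star_copy _ _ _ _ _ v s g) => // [|x xs|j jr].
- by rewrite card_s; lia.
- apply: mono; rewrite ?sa ?mem_head // ?inE ?xs ?orbT //.
  by apply: contraNneq (andP us).1 => ->.
have ss : j.*2.+1 < size s by rewrite -ltnS card_s; lia.
have ss' : j.*2 < size s by apply: ltnW.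
apply: mono; try by apply: sa; rewrite inE mem_nth ?orbT.
by rewrite nth_uniq ?ltn_eqF //; case/andP: us.
Qed.

(* The vertex [v] is joined in the dominant colour [d] to everything in [B], a
   union of classes of [f]; the edges [u_i w_(i+1)], with [u_i] and [w_i] two
   vertices of the [i]-th class in [B] and indices taken cyclically, are
   independent and of colour [d]. *)
Lemma dominant_star_at n k (c : coloring n k) (d : 'I_k)
    (f : 'I_n -> 'I_k) t r v (B : {set 'I_n}) (J : {set 'I_k}) :
  (forall x y, f x != f y -> c [set x; y] = d) ->
  (forall i, i \in J -> exists x y, [/\ x != y, f x = i & f y = i]) ->
  v \notin B -> {in B, forall x, c [set v; x] = d} ->
  (forall x, f x \in J -> x \in B) -> 0 < t -> t <= #|B|.+1 -> r <= #|J| ->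
  1 < #|J| -> has_monochromatic_copy c (star_graph t r).
Proof.
move=> dom cls vB cB JB t0 tB rJ J1.
have [uw uwP] : exists uw : 'I_k -> 'I_n * 'I_n, forall i, i \in J ->
    [/\ (uw i).1 != (uw i).2, f (uw i).1 = i & f (uw i).2 = i].
  exists (fun i => odflt (v, v) [pick p : 'I_n * 'I_n |
    [&& p.1 != p.2, f p.1 == i & f p.2 == i]]) => i iJ.
  case: pickP => [p /and3P[? /eqP ? /eqP ?] //|none].
  have [x [y [xy fx fy]]] := cls i iJ.
  by have := none (x, y); rewrite /= xy fx fy eqxx.
pose m := #|J|; pose e j := nth d (enum J) j.
have eJ j : j < m -> e j \in J.
  by move=> jm; rewrite -mem_enum mem_nth // -cardE.
have e_inj i j : i < m -> j < m -> e i = e j -> i = j.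
  by move=> im jm /eqP; rewrite nth_uniq ?enum_uniq -?cardE // => /eqP.
have m0 : 0 < m by apply: ltnW.
(* Position [2j] belongs to class [j], position [2j + 1] to the cyclically next class. *)
pose idx i := if odd i then i./2.+1 %% m else i./2.
pose g i := if odd i then (uw (e (idx i))).2 else (uw (e (idx i))).1.
have idxm i : i < r.*2 -> idx i < m.
  by move=> ir; rewrite /idx; case: ifP; rewrite ?ltn_mod //; lia.
have fg i : i < r.*2 -> f (g i) = e (idx i).
  move=> /idxm im; have [_ f1 f2] := uwP _ (eJ _ im).
  by rewrite /g; case: (odd i).
have modS i j : i < m -> j < m -> i.+1 %% m = j.+1 %% m -> i = j.
  move=> im jm /eqP.
  by rewrite -addn1 -(addn1 j) eqn_modDr !modn_small // => /eqP.
have g_inj : {in gtn r.*2 &, injective g}.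
  move=> i j; rewrite !inE => ir jr E.
  (* Equal vertices lie in one class; opposite parities would pick its two distinct vertices, and
     equal parities give equal halves. *)
  have idxE : idx i = idx j by apply: e_inj; rewrite ?idxm // -!fg ?E.
  have [ne _ _] := uwP _ (eJ _ (idxm j jr)).
  have [im jm] : i./2 < m /\ j./2 < m by split; lia.
  rewrite -[i]odd_double_half -[j]odd_double_half.
  move: ne E; rewrite /g idxE => ne; move: idxE ne; rewrite /idx.
  by case: (odd i); case: (odd j) => E ne E'; rewrite ?(modS _ _ im jm E) ?E //;
    rewrite E' eqxx in ne.
pose s := [seq g i | i <- iota 0 r.*2].
have us : uniq s.
  rewrite map_inj_in_uniq ?iota_uniq // => i j; rewrite !mem_iota !add0n.
  exact: g_inj.
have sB : {subset s <= B}.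
  move=> _ /mapP[i + ->]; rewrite mem_iota add0n => ir.
  by apply: JB; rewrite fg // eJ ?idxm.
(* The matched vertices come first, at the positions expected by [mono_star_copy]; the rest of [B]
   fills up the leaves. *)
pose s' := s ++ [seq x <- enum B | x \notin s].
have us' : uniq s'.
  rewrite cat_uniq us filter_uniq ?enum_uniq // andbT.
  by apply/hasPn=> x; rewrite mem_filter => /andP[].
have s'B : s' =i B.
  move=> x; rewrite mem_cat mem_filter mem_enum.
  by case: (boolP (x \in s)) => //= /sB->.
have size_s : size s = r.*2 by rewrite size_map size_iota.
apply: (@mono_star_copy _ _ _ _ _ v s' d) => // [||x xs'|j jr].
- by rewrite -(card_uniqP us') (eq_card s'B).
- by rewrite /= s'B vB.
- by apply: cB; rewrite -s'B.
have [j0 j1] : j.*2 < r.*2 /\ j.*2.+1 < r.*2 by split; lia.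
rewrite !nth_cat size_s j0 j1 !(nth_map 0) ?size_iota // !nth_iota // !add0n.
apply: dom; rewrite !fg // /idx /= odd_double /= uphalf_double doubleK.
have jm : j < m by apply: leq_trans jr rJ.
apply/eqP=> /e_inj; rewrite ltn_mod m0 => /(_ jm isT).
have m1 : 1 < m by [].
have [jE|] := eqVneq j.+1 m; first by rewrite jE modnn => j0'; lia.
by move=> jne; rewrite modn_small; lia.
Qed.

Lemma sum_card_classes (T I : finType) (f : T -> I) :
  \sum_i #|[set x | f x == i]| = #|T|.
Proof.
rewrite -sum1_card (partition_big f predT) //=; apply: eq_bigr => i _.
by rewrite -sum1_card; apply: eq_bigl => x; rewrite !inE.
Qed.

Lemma dominant_star n k (c : coloring n k) (d : 'I_k) (f : 'I_n -> 'I_k)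
    t r p q :
  4 < k -> 0 < t < n -> r <= k - 2 -> q <= k - 3 -> t - 2 = p * (k - 2) + q ->
  t + p - 1 <= n ->
  (forall x y, x != y -> (f x != f y) || (f x == d) -> c [set x; y] = d) ->
  (forall i, i != d -> exists x y, [/\ x != y, f x = i & f y = i]) ->
  has_monochromatic_copy c (star_graph t r).
Proof.
move=> k4 /andP[t0 tn] rk qk tE tpn dom cls.
have dom' x y : f x != f y -> c [set x; y] = d.
  by move=> fxy; apply: dom; rewrite ?fxy //; apply: contraNneq fxy => ->.
have card_d : #|[set~ d]| = k.-1 by rewrite cardsC1 card_ord.
(* A vertex of class [d] has only edges of colour [d] and serves as centre; otherwise the centre
   comes from a smallest class. *)
have [/existsP[v /eqP fv]|/existsPn nod] := boolP [exists v, f v == d].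
  apply: (@dominant_star_at _ _ _ d f _ _ v [set~ v] [set~ d]) => //.
  - by move=> i; rewrite !inE; apply: cls.
  - by rewrite !inE negbK.
  - by move=> x; rewrite !inE => xv; apply: dom;
      rewrite 1?eq_sym // fv eqxx orbT.
  - by move=> x; rewrite !inE; apply: contraNneq => ->; rewrite fv.
  - by rewrite cardsC1 card_ord; lia.
  - by rewrite card_d; lia.
  by rewrite card_d; lia.
have [i0 i0d] : exists i0, i0 != d.
  have /card_gt0P[i0] : 0 < #|[set~ d]| by rewrite card_d; lia.
  by rewrite !inE; exists i0.
case: (@arg_minnP _ i0 (predC1 d) (fun i => #|[set x | f x == i]|) i0d).
move=> i /= id imin.
have [v [_ [_ fv _]]] := cls i id.
have sum_le : k.-1 * #|[set x | f x == i]| <= n.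
  rewrite -[X in _ <= X](card_ord n) -(sum_card_classes f) (bigD1 d) //=.
  apply: leq_trans (leq_addl _ _); rewrite -card_d -sum_nat_const big_mkcond /=.
  rewrite [X in _ <= X]big_mkcond /=.
  by apply: leq_sum => j _; rewrite !inE; case: ifP => // /imin.
have card_B : #|[set x | f x != i]| = n - #|[set x | f x == i]|.
  by rewrite cardsCs card_ord; congr (n - _); apply: eq_card => x;
    rewrite !inE negbK.
have card_J : #|[set~ d] :\ i| = k - 2.
  by move: card_d; rewrite (cardsD1 i) !inE id; lia.
apply: (@dominant_star_at _ _ _ d f _ _ v [set x | f x != i] ([set~ d] :\ i))
    => //.
- by move=> j; rewrite !inE => /andP[_]; apply: cls.
- by rewrite !inE fv eqxx.
- by move=> x; rewrite !inE => fx; apply: dom'; rewrite fv eq_sym.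
- by move=> x; rewrite !inE => /andP[].
- rewrite card_B; move: sum_le; set s := #|_| => sum_le.
  (* Here [n - s <= t - 2] and [(k - 1) * s <= n] give [s * (k - 2) <= p * (k - 2) + q], so [s <= p]
     because [q < k - 2], against [t + p - 1 <= n]. *)
  rewrite leqNgt; apply/negP => lt_t.
  have : s * (k - 2) <= t - 2 by lia.
  nia.
- by rewrite card_J.
by rewrite card_J; lia.
Qed.

Lemma gallai_ramsey_upper n k (c : coloring n k) t r p q :
  4 < k -> k < t < n -> r.*2 < t -> r <= k - 2 -> q <= k - 3 ->
  t - 2 = p * (k - 2) + q -> t + p - 1 <= n -> exact_coloring c ->
  has_rainbow_copy c (path_graph 5) \/
  has_monochromatic_copy c (star_graph t r).
Proof.
move=> k4 /andP[kt tn] rt rk qk tE tpn c_exact.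
have [|Fc] := rainbow_P5_or_free c; [by left | right].
have cC x y : c [set x; y] = c [set y; x] by rewrite setUC.
have n_gt4 : 4 < #|'I_n| by rewrite card_ord; lia.
have k_gt4 : 4 < #|'I_k| by rewrite card_ord.
have c_onto i : exists u v, u != v /\ c [set u; v] = i.
  have [_ /imset2P[u v _ + ->] <-] := c_exact i; rewrite inE => uv.
  by exists u, v.
have t0 : 0 < t < n by lia.
have [mono|le2] := mono_off_or_two_colors cC Fc n_gt4 k_gt4 c_onto.
  exact: mono_off_star mono.
have [d [f [dom cls]]] := dominant_color cC n_gt4 k_gt4 c_onto le2.
exact: dominant_star tE _ dom cls.
Qed.

(** * Lower bound: the two extremal colourings *)

Definition gallai_ramsey_free n k t r : Prop :=
  exists c : coloring n k, [/\ exact_coloring c,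
    ~ has_rainbow_copy c (path_graph 5) &
    ~ has_monochromatic_copy c (star_graph t r)].

Lemma gallai_ramsey_free_of n k (h : 'I_n -> 'I_n -> 'I_k) t r :
  0 < k -> (forall x y, h x y = h y x) ->
  (forall i, exists x y, x != y /\ h x y = i) ->
  rainbow_P5_free h ->
  (forall (f : 'I_t -> 'I_n) i, injective f ->
     (forall x y, star_rel r x y -> h (f x) (f y) = i) -> False) ->
  gallai_ramsey_free n k t r.
Proof.
move=> k0 hC h_onto Fh no_star; have [c ch] := exists_coloring k0 hC.
exists c; split=> [i||].
- have [x [y [xy <-]]] := h_onto i; exists [set x; y]; last exact: ch.
  by apply/imset2P; exists x y; rewrite ?inE.
- exact: rainbow_P5_free_no_copy ch Fh.
by case/(mono_star_embedding ch)=> f [i [f_inj]]; apply: no_star.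
Qed.

Lemma star_rel_center t r (x y : 'I_t) :
  x = 0 :> nat -> 0 < y -> star_rel r x y.
Proof. by rewrite /star_rel /star_arc => -> ->. Qed.

Lemma star_rel_triangle t r (x y : 'I_t) :
  0 < r -> x = 1 :> nat -> y = 2 :> nat -> star_rel r x y.
Proof.
move=> r0 x1 y2; rewrite /star_rel /star_arc; apply/orP; left; apply/orP; right.
by apply/existsP; exists (Ordinal r0); rewrite x1 y2.
Qed.

(** Vertex [0] is the exceptional one; its surplus edges reuse colour [1], keeping [ord0] for the
    edges that avoid it. *)
Definition spoke_coloring k n (x y : 'I_n) : 'I_k.+1 :=
  let spoke z := inord (if z <= k then z else 1) in
  if x == 0 :> nat then spoke (nat_of_ord y)
  else if y == 0 :> nat then spoke (nat_of_ord x) else ord0.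

Lemma spoke_coloringC k n (x y : 'I_n) :
  spoke_coloring k x y = spoke_coloring k y x.
Proof.
rewrite /spoke_coloring; case: eqP => [x0|_]; case: eqP => [y0|_] //.
by rewrite x0 y0.
Qed.

Lemma spoke_coloring0 k n (x y : 'I_n) :
  0 < k -> x != y -> (spoke_coloring k x y == ord0) = (x * y != 0).
Proof.
move=> k0 xy; rewrite /spoke_coloring muln_eq0 -val_eqE.
have s0 z : z != 0 -> (inord (if z <= k then z else 1) : 'I_k.+1) != 0 :> nat.
  by rewrite inordK; case: ifP; lia.
have [x0|x0] := eqVneq (x : nat) 0.
  by apply/negbTE/s0; apply: contraNneq xy => y0; rewrite -val_eqE /= x0 y0.
by have [y0|y0] := eqVneq (y : nat) 0; first exact/negbTE/s0.
Qed.

(** Vertex [0] lies on at most two of the four edges, so two others share the colour [ord0]. *)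
Lemma spoke_rainbow_free k n : 0 < k -> rainbow_P5_free (@spoke_coloring k n).
Proof.
move=> k0 x y z u v us; apply/negP.
have zero (a b : 'I_n) : (a : nat) != 0 -> (b : nat) != 0 ->
    spoke_coloring k a b = ord0 :> 'I_k.+1.
  by rewrite /spoke_coloring => /negbTE-> /negbTE->.
have uniq0 (a b : 'I_n) : a != b -> (a : nat) = 0 -> (b : nat) != 0.
  by move=> ab a0; apply: contraNneq ab => b0; rewrite -val_eqE /= a0 b0.
move: us; rewrite /= !inE !negb_or !andbT.
case/and4P=> /and4P[xy xz xu xv] /and3P[yz yu yv] /andP[zu zv] uv.
have [z0|z0] := eqVneq (z : nat) 0.
  rewrite zero ?(uniq0 z) // 1?eq_sym //
      [spoke_coloring k u v]zero ?(uniq0 z) //.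
  by rewrite eqxx /= ?andbF.
have [x0|x0] := eqVneq (x : nat) 0.
  rewrite (@zero z u) ?(uniq0 x) // (@zero u v) ?(uniq0 x) //.
  by rewrite eqxx /= ?andbF.
have [y0|y0] := eqVneq (y : nat) 0.
  rewrite (@zero z u) ?(uniq0 y) // (@zero u v) ?(uniq0 y) //.
  by rewrite eqxx /= ?andbF.
by rewrite (@zero x y) // (@zero y z) // eqxx.
Qed.

Lemma gallai_ramsey_free_spoke k t r :
  1 < k -> k < t -> 0 < r -> 2 < t -> gallai_ramsey_free t k t r.
Proof.
case: k => // k k0 kt r0 t3; have t0 : 0 < t by lia.
have t1 : 1 < t by lia.
apply: (@gallai_ramsey_free_of _ _ (@spoke_coloring k t)) => //.
- exact: spoke_coloringC.
- move=> i; have [i0|i0] := eqVneq i ord0.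
    exists (Ordinal t1), (Ordinal t3); split=> //.
  have it : i < t by apply: ltn_trans kt.
  exists (Ordinal t0), (Ordinal it); split.
    by rewrite -val_eqE /= eq_sym.
  by rewrite /spoke_coloring /= -ltnS ltn_ord inord_val.
- exact: spoke_rainbow_free.
move=> f i f_inj fi.
have f_ne x y : star_rel r x y -> f x != f y.
  by rewrite (inj_eq f_inj) => xy; apply: contraTneq xy => ->;
    rewrite star_rel_irrefl.
have prod x y : star_rel r x y -> (i == ord0) = (f x * f y != 0).
  by move=> xy; rewrite -(fi x y xy) spoke_coloring0 ?f_ne.
(* A copy on [t] vertices spans [K_t] and so has an edge at vertex [0], excluding [ord0]; in another
   colour all its edges would pass through vertex [0], which a triangle prevents. *)
have [i0|i0] := eqVneq i ord0.
  pose x := invF f_inj (Ordinal t0).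
  have fx : f x = 0 :> nat by rewrite f_invF.
  have [y xy] : exists y, star_rel r x y.
    have [x0|x0] := eqVneq (x : nat) 0.
      by exists (Ordinal t1); apply: star_rel_center.
    exists (Ordinal t0); rewrite [star_rel _ _ _]star_rel_sym.
    by apply: star_rel_center; rewrite // lt0n.
  by have := prod x y xy; rewrite i0 fx.
have r01 : star_rel r (Ordinal t0) (Ordinal t1) by apply: star_rel_center.
have r02 : star_rel r (Ordinal t0) (Ordinal t3) by apply: star_rel_center.
have r12 : star_rel r (Ordinal t1) (Ordinal t3) by apply: star_rel_triangle.
have := prod _ _ r01; have := prod _ _ r02; have := prod _ _ r12.
have := f_ne _ _ r01; have := f_ne _ _ r02; have := f_ne _ _ r12.
rewrite (negbTE i0) !muln_eq0 -!val_eqE /=; lia.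
Qed.

(** Residues modulo [m] are the evenly sized classes, and [ord0] is the colour between them. *)
Definition class_coloring k m n (x y : 'I_n) : 'I_k.+1 :=
  if x == y %[mod m] then inord (x %% m).+1 else ord0.

Lemma class_coloringC k m n (x y : 'I_n) :
  class_coloring k m x y = class_coloring k m y x.
Proof. by rewrite /class_coloring eq_sym; case: eqP => // ->. Qed.

(** Two consecutive edges inside classes lie in the same class. Hence in a rainbow path both the
    first two and the last two edges would include one of colour [ord0]. *)
Lemma class_rainbow_free k m n : rainbow_P5_free (@class_coloring k m n).
Proof.
move=> x y z u v _; apply/negP.
have adj (a b e : 'I_n) : class_coloring k m a b != class_coloring k m b e ->
    (class_coloring k m a b == ord0) || (class_coloring k m b e == ord0).
  rewrite /class_coloring; case: (a %% m =P b %% m) => [->|];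
    last by rewrite eqxx.
  by case: (b %% m =P e %% m); rewrite !eqxx ?orbT.
rewrite /= !inE !negb_or !andbT => /and3P[/and3P[xz xu xv] /andP[yu yv] zv].
by move: xu xv yu yv; case/orP: (adj _ _ _ xz) => /eqP->;
  case/orP: (adj _ _ _ zv) => /eqP->; rewrite eqxx.
Qed.

Lemma card_class m n p j : j < m -> p * m <= n ->
  p <= #|[set x : 'I_n | x %% m == j]|.
Proof.
move=> jm pmn; have lt (l : 'I_p) : j + l * m < n by have := ltn_ord l; nia.
have l_inj : injective (fun l => Ordinal (lt l)).
  move=> l1 l2 /(congr1 val) /= /eqP;
      rewrite eqn_add2l eqn_pmul2r ?(leq_ltn_trans _ jm) //.
  by move=> /eqP/val_inj.
rewrite -[p in p <= _]card_ord -(card_codom l_inj); apply: subset_leq_card.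
by apply/subsetP=> _ /codomP[l ->]; rewrite inE /= addnC modnMDl modn_small.
Qed.

Lemma gallai_ramsey_free_classes k m n p t r :
  k = m.+1 -> 1 < m -> 1 < p -> p * m <= n -> n <= t - 2 + p -> 1 < t ->
  gallai_ramsey_free n k t r.
Proof.
move=> -> m1 p1 pmn nt t1; have t0 : 0 < t by apply: ltnW.
apply: (@gallai_ramsey_free_of _ _ (@class_coloring m m n)) => //.
- exact: class_coloringC.
- move=> i; have [i0|i0] := eqVneq i ord0.
    have n0 : 0 < n by nia.
    have n1 : 1 < n by nia.
    exists (Ordinal n0), (Ordinal n1); split=> //.
    by rewrite i0 /class_coloring /= mod0n modn_small.
  (* Colour [i] belongs to residue [i - 1], which has the members [i - 1] and [i - 1 + m] because
     [n >= 2 * m]. *)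
  have im : i.-1 < m by have := ltn_ord i; lia.
  have in' : i.-1 < n by nia.
  have imn : i.-1 + m < n by nia.
  exists (Ordinal in'), (Ordinal imn); split; first by rewrite -val_eqE /=; lia.
  rewrite /class_coloring /= modnDr eqxx modn_small // prednK ?inord_val //.
  by rewrite lt0n.
- exact: class_rainbow_free.
move=> f i f_inj fi.
pose v := Ordinal t0; pose cls := [set y : 'I_n | y %% m == f v %% m].
have m0 : 0 < m by lia.
have card_cls : p <= #|cls| by apply: card_class; rewrite // ltn_mod.
(* As [m > 1], the residue following that of [f v] is a different class, contained in the
   complement. *)
have card_clsC : p <= #|~: cls|.
  apply: leq_trans (@card_class m n p ((f v).+1 %% m) _ pmn) _.
    by rewrite ltn_mod.
  apply: subset_leq_card; apply/subsetP=> x; rewrite !inE => /eqP->.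
  by rewrite -addn1 -[X in _ != X %% _]addn0 eqn_modDl mod0n modn_small.
have sub (L : {set 'I_n}) : (forall x : 'I_t, x != v -> f x \in L) ->
    t.-1 <= #|L|.
  move=> fL; rewrite -[t]card_ord -(cardsC1 v) -(card_imset _ f_inj).
  by apply: subset_leq_card; apply/subsetP=> _ /imsetP[x xv ->]; apply: fL;
    rewrite !inE in xv.
have := cardsC cls; rewrite card_ord => card_n.
have adj_v x : x != v -> class_coloring m m (f v) (f x) = i.
  by move=> xv; apply: fi; apply: star_rel_center; rewrite // lt0n.
(* The [t - 1] leaves lie all outside the class of the centre or all inside it, but either side has
   at most [n - p <= t - 2] vertices. *)
have [i0|i0] := eqVneq i ord0.
  suff : t.-1 <= #|~: cls| by lia.
  apply: sub => x /adj_v; rewrite !inE /class_coloring i0 eq_sym;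
    case: eqP => //.
  move=> _ /(congr1 val) /=; rewrite inordK //.
  by rewrite ltnS ltn_mod.
suff : t.-1 <= #|cls| by lia.
apply: sub => x /adj_v; rewrite !inE /class_coloring eq_sym; case: eqP => //.
by move=> _ E; rewrite -E eqxx in i0.
Qed.

Theorem theorem3p1 (k r t p q : nat)
  (hk5 : 5 <= k) (hkt : k <= t - 1)
  (hr1 : 1 <= r) (hrk : r <= k - 2)
  (htr : 2 * r + 2 <= t)
  (hq : q <= k - 3)
  (hpq : t - 2 = p * (k - 2) + q) :
  gallai_ramsey_number k (path_graph 5) (star_graph t r)
    (maxn (t + p - 1) (t + 1)).
Proof.
split.
  split=> [|n c]; last rewrite geq_max => /andP[tpn tn].
    apply: leq_trans (leq_bin2l 2 (leq_maxr _ _)).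
    by rewrite addn1 binS bin1; lia.
  by apply: (@gallai_ramsey_upper _ _ _ _ _ p q) => //; lia.
move=> M [_ boundM]; rewrite leqNgt; apply/negP => lt_M.
suff [n Mn [c [c_exact no_path no_star]]] :
    exists2 n, M <= n & gallai_ramsey_free n k t r.
  by case: (boundM n c Mn c_exact).
(* The maximum is [t + p - 1] for [p >= 2] and [t + 1] otherwise; each colouring has one vertex
   fewer. *)
have [p2|p1] := leqP 2 p; last first.
  by exists t; [lia | apply: gallai_ramsey_free_spoke; lia].
exists (t + p - 2); first lia.
by apply: (@gallai_ramsey_free_classes k k.-1 _ p); nia.
Qed.
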